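(* Let $n\ge2$. The map $T_3$ (which sends a factorisation to the associated unlabeled plane tree) is a bijection between the set $\mathcal F_n^{\uparrow}$ of increasing factorisations of size $n$ and the set $\Pi_n$ of plane trees with $n$ vertices.
   Context: A minimal factorisation of size $n\ge2$ is a tuple $(\tau_1,\dots,\tau_{n-1})$ of transpositions of $\{1,\dots,n\}$ with $\tau_{n-1}\circ\dots\circ\tau_1=(1\ 2\ \dots\ n)$ ($\tau_1$ applied first). Writing $\tau_i=(a_i\ b_i)$ with $a_i<b_i$, it is increasing if $a_1\le a_2\le\dots\le a_{n-1}$; $\mathcal F_n^{\uparrow}$ is the set of increasing factorisations of size $n$. A plane tree is a rooted tree where, for every vertex $v$, a total order is given on the edges stemming from $v$ (the edges going from $v$ to its children); plane trees are considered up to isomorphism preserving root and orders. $\Pi_n$ is the set of plane trees with $n$ vertices. For a minimal factorisation $f=(\tau_1,\dots,\tau_{n-1})$ of size $n$, consider the graph with vertices labeled $1,\dots,n$ and, for each $k\in\{1,\dots,n-1\}$, an edge labeled $k$ between the vertices labeled $i$ and $j$ where $\tau_k=(i\ j)$. This graph is a tree. $T_1(f)$ is this labeled tree, rooted at the vertex labeled $1$ and made into a plane tree by ordering the edges stemming from each vertex by increasing edge label. $T_3(f)\in\Pi_n$ is the plane tree obtained from $T_1(f)$ by forgetting all vertex labels and edge labels (keeping the shape, root and plane order). *)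

(* Defs.v *)
From mathcomp Require Import all_boot all_fingroup.
From mathcomp Require Import classical_sets functions.

Set Implicit Arguments.
Unset Strict Implicit.
Unset Printing Implicit Defensive.

(* The set {1, ..., n} is represented by 'I_n: the element i
   of the former is the ordinal of value i - 1.  Likewise the indices
   1, ..., n-1 of a factorisation become the elements of 'I_n.-1. *)

Section Factorisations.

Variable n : nat.

Definition long_cycle : 'S_n := perm (@ordS_inj n).

(* In 'S_n the left factor of a product acts first: (s * t) x = t (s x). *)
Definition minimal_factorisation (f : n.-1.-tuple 'S_n) : Prop :=
  (forall k, exists a b : 'I_n, a < b /\ tnth f k = tperm a b) /\
  (\prod_(k < n.-1) tnth f k)%g = long_cycle.

(* For a < b, the pair (a, b) is determined by tperm a b. *)
Definition increasing (f : n.-1.-tuple 'S_n) : Prop :=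
  forall (k l : 'I_n.-1) (a b c d : 'I_n),
    a < b -> tnth f k = tperm a b ->
    c < d -> tnth f l = tperm c d ->
    k <= l -> a <= c.

Definition increasing_factorisations : set (n.-1.-tuple 'S_n) :=
  [set f | minimal_factorisation f /\ increasing f]%classic.

End Factorisations.

Arguments increasing_factorisations n : clear implicits.

(* A plane tree is the ordered list of the subtrees hanging from its root, so
   that isomorphic plane trees are equal. *)
Inductive plane_tree : Type := PNode of seq plane_tree.

Fixpoint nb_vertices (t : plane_tree) : nat :=
  let: PNode s := t in (sumn [seq nb_vertices u | u <- s]).+1.

Definition plane_trees (n : nat) : set plane_tree :=
  [set t | nb_vertices t = n]%classic.

(* Plane trees with vertex labels in V and edge labels in E: a vertex carries
   its label and the ordered list of the edges stemming from it, each given by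
   its label and the subtree to which it leads. *)
Inductive labeled_plane_tree (V E : Type) : Type :=
  LNode of V & seq (E * labeled_plane_tree V E).

Fixpoint forget_labels (V E : Type) (t : labeled_plane_tree V E) : plane_tree :=
  let: LNode _ s := t in PNode [seq forget_labels e.2 | e <- s].

Section Trees.

Variable n : nat.
Implicit Types (f : n.-1.-tuple 'S_n) (v w : 'I_n) (k : 'I_n.-1).

Definition edge f k v w : bool := (v != w) && (tnth f k == tperm v w).

(* The edges at v other than the parent edge p (None at the root), with their
   other endpoints, by increasing label. *)
Definition stemming_edges f (p : option 'I_n.-1) v : seq ('I_n.-1 * 'I_n) :=
  [seq e <- [seq (k, w) | k <- enum 'I_n.-1, w <- enum 'I_n]
     | (Some e.1 != p) && edge f e.1 v e.2].

Fixpoint subtree_at (m : nat) f (p : option 'I_n.-1) v :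
    labeled_plane_tree 'I_n 'I_n.-1 :=
  if m is m'.+1 then
    LNode v [seq (e.1, subtree_at m' f (Some e.1) e.2)
               | e <- stemming_edges f p v]
  else LNode v [::].

(* The exploration bound n never truncates: in a tree with n vertices every
   vertex is at distance at most n - 1 from the root. *)
Definition T1 (hn : 2 <= n) f : labeled_plane_tree 'I_n 'I_n.-1 :=
  subtree_at n f None (Ordinal (ltnW hn)).

Definition T3 (hn : 2 <= n) f : plane_tree := forget_labels (T1 hn f).

End Trees.

(* Main.v *)
Require Import Defs.
From mathcomp Require Import all_boot all_fingroup.
From mathcomp Require Import classical_sets functions.
From mathcomp Require Import zify.

Set Implicit Arguments.
Unset Strict Implicit.
Unset Printing Implicit Defensive.

(* Plane trees and increasing factorisations are both encoded by binary trees
   with n leaves.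

   A binary tree with leaves numbered lo, lo+1, ... yields chords: a node with
   leftmost leaf a and rightmost leaf b yields the chord (a, b).  The chords in
   lexicographic order multiply to the cycle (lo lo+1 ...), so they form an
   increasing minimal factorisation.  Conversely, a minimal factorisation with
   product r must start with a transposition that splits a cycle of r, since
   the number of cycles changes by one at each step.  When the cycles of r are
   intervals, the transpositions containing the smallest point lo therefore
   cut its cycle into consecutive intervals, from left to right, and the
   argument is repeated on the intervals that are left.

   In the graph of the chords, the edges at the smallest point lo of an
   interval join it to the right ends of the intervals cut from its cycle,
   whereas the largest point hi is joined first to lo, and its other edges are
   its edges in the last of those intervals.  The plane trees rooted at lo and
   at hi (without the edge joining them to the rest of the graph) hence satisfy
   a mutual recursion, which determines the binary tree. *)

(** * Products of transpositions, numbers of cycles, and cycles on intervals *)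

Section TranspositionProducts.

Variable N : nat.
Implicit Types (s : seq (nat * nat)) (x y : 'I_N.+1) (X : pred nat).

Definition transp (a b : nat) : 'S_N.+1 := tperm (inord a) (inord b).

Definition prod_transp s : 'S_N.+1 := (\prod_(e <- s) transp e.1 e.2)%g.

Lemma prod_transp_nil : prod_transp [::] = 1%g.
Proof. by rewrite /prod_transp big_nil. Qed.

Lemma prod_transp_cons e s :
  prod_transp (e :: s) = (transp e.1 e.2 * prod_transp s)%g.
Proof. by rewrite /prod_transp big_cons. Qed.

Lemma prod_transp_cat s1 s2 :
  prod_transp (s1 ++ s2) = (prod_transp s1 * prod_transp s2)%g.
Proof. by rewrite /prod_transp big_cat. Qed.

Lemma inordE a : a <= N -> (inord a : 'I_N.+1) = a :> nat.
Proof. by move=> aN; rewrite inordK. Qed.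

Lemma eq_inord a b : a <= N -> b <= N -> (inord a == inord b :> 'I_N.+1) = (a == b).
Proof. by move=> aN bN; rewrite -val_eqE /= !inordE. Qed.

Lemma transpE a b x : a <= N -> b <= N ->
  transp a b x = (if x == a :> nat then b else if x == b :> nat then a else x) :> nat.
Proof.
move=> aN bN; rewrite /transp permE /= -!val_eqE /= !inordE //.
by case: eqP => _; [rewrite inordE | case: eqP => _ //; rewrite inordE].
Qed.

(** Every transposition of [s] then preserves membership in [X]. For [pred1 a] this means that no
    pair moves [a]; degenerate pairs are allowed. *)
Definition respects X s :=
  all (fun e => [&& e.1 <= N, e.2 <= N & X e.1 == X e.2]) s.

Lemma prod_transp_respects X s x : respects X s -> X (prod_transp s x) = X x.
Proof.
elim: s x => [|[a b] s IH] x /=; first by rewrite prod_transp_nil perm1.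
case/andP=> /and3P[aN bN /eqP Xab] Xs.
rewrite prod_transp_cons permM IH // transpE //=.
by case: eqP => [->|_] //; case: eqP => [->|].
Qed.

Lemma prod_transp_fix s x : respects (pred1 (val x)) s -> prod_transp s x = x.
Proof.
move=> xs; apply/val_inj/eqP.
by have /= -> := prod_transp_respects x xs.
Qed.

Lemma porbit_respects X s x y :
  respects X s -> y \in porbit (prod_transp s) x -> X y = X x.
Proof.
move=> Xs /porbitP[i ->]; elim: i => [|i IH]; first by rewrite expg0 perm1.
by rewrite expgSr permM prod_transp_respects.
Qed.

Lemma transp_comm a b s : a <= N -> b <= N ->
  respects (pred1 a) s -> respects (pred1 b) s ->
  (prod_transp s * transp a b = transp a b * prod_transp s)%g.
Proof.
move=> aN bN sa sb.
rewrite [RHS]conjgC /transp tpermJ !prod_transp_fix //=; by rewrite inordE.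
Qed.

Lemma transp_transp a b h : a <= N -> b <= N -> h <= N -> a != b -> a != h ->
  (transp a h * transp b h = transp b h * transp a b)%g.
Proof.
move=> aN bN hN ab ah.
by rewrite conjgC /transp tpermJ tpermR tpermD // eq_inord // eq_sym.
Qed.

Definition nb_cycles (r : 'S_N.+1) : nat := #|porbits r|.

(** A transposition splits a cycle containing both its points and merges two cycles otherwise; the
    doubled term avoids a subtraction. *)
Lemma nb_cycles_transp a b (r : 'S_N.+1) :
  nb_cycles (transp a b * r)%g + (inord a \notin porbit r (inord b)).*2
  = nb_cycles r + (inord a != inord b :> 'I_N.+1).
Proof. exact: porbits_mul_tperm. Qed.

(** The identity has [N.+1] cycles, and each transposition lowers this number by at most one. *)
Lemma leq_nb_cycles_size s : N.+1 <= nb_cycles (prod_transp s) + size s.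
Proof.
elim: s => [|[a b] s IH] /=.
  rewrite prod_transp_nil addn0 /nb_cycles.
  rewrite card_imset ?card_ord // => x y exy.
  have /porbitP[i ->] : x \in porbit (1 : 'S_N.+1)%g y by rewrite -exy porbit_id.
  by rewrite expg1n perm1.
rewrite prod_transp_cons; have /= := nb_cycles_transp a b (prod_transp s).
case: (inord a =P inord b :> 'I_N.+1) => [->|_]; first by rewrite porbit_id /=; lia.
by case: (inord a \in _) => /=; lia.
Qed.

(** The equality case of the preceding bound: read from the right, each transposition merges two
    cycles. *)
Definition minimal s := nb_cycles (prod_transp s) + size s == N.+1.

Lemma minimal_cons a b s : minimal ((a, b) :: s) -> minimal s.
Proof.
rewrite /minimal prod_transp_cons /= => /eqP min_s.
have := nb_cycles_transp a b (prod_transp s); have := leq_nb_cycles_size s.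
case: (inord a =P inord b :> 'I_N.+1) => [->|_]; first by rewrite porbit_id /=; lia.
by case: (inord a \in _) => /=; lia.
Qed.

(* Otherwise the first transposition would merge two cycles of the product of
   the others, which would then have too many cycles. *)
Lemma minimal_porbit a b s : minimal ((a, b) :: s) ->
  inord b \in porbit (prod_transp ((a, b) :: s)) (inord a).
Proof.
move=> min_ab; have := minimal_cons min_ab; move: min_ab.
rewrite /minimal prod_transp_cons /= => /eqP min_ab /eqP min_s.
rewrite porbit_sym.
have := nb_cycles_transp a b (transp a b * prod_transp s)%g.
rewrite mulgA -[(transp a b * transp a b)%g]/(tperm _ _ * tperm _ _)%g tperm2 mul1g.
by case: (inord a \in _) => //=; case: (_ == _) => /=; lia.
Qed.

(* The last pair is a degenerate transposition, so that the recursion is uniform. *)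
Fixpoint cycle_pairs lo m : seq (nat * nat) :=
  if m is m'.+1 then (lo, lo + m') :: cycle_pairs lo.+1 m' else [::].

Lemma cycle_pairs_respects X lo m : lo + m <= N.+1 ->
  (forall a b, lo <= a < lo + m -> lo <= b < lo + m -> X a = X b) ->
  respects X (cycle_pairs lo m).
Proof.
elim: m lo => //= m IH lo loN Xlo; rewrite IH ?andbT; first last.
- by move=> a b ha hb; apply: Xlo; lia.
- by lia.
by apply/and3P; split; [lia | lia | apply/eqP/Xlo; lia].
Qed.

(** The first pair sends [lo] to the right end, which the cycle on the other points sends to
    [lo.+1]; it sends the right end to [lo], which the later pairs fix. *)
Lemma cycle_pairsE lo m x : lo + m <= N.+1 -> lo <= x < lo + m ->
  prod_transp (cycle_pairs lo m) x = (if x.+1 == lo + m then lo else x.+1) :> nat.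
Proof.
elim: m lo x => [|m IH] lo x loN xlo; first by lia.
rewrite /= prod_transp_cons permM /=.
have := @transpE lo (lo + m) x ltac:(lia) ltac:(lia); set y := transp _ _ _.
case: eqP => [xlo' yE|xlo'].
  case: (posnP m) => [m0|m0].
    rewrite prod_transp_fix ?m0 // yE; case: eqP; lia.
  by rewrite IH ?yE; [|lia|lia]; case: eqP; case: eqP; lia.
case: eqP => [xhi yE|xhi yE].
  rewrite prod_transp_fix; first by rewrite yE; case: eqP; lia.
  by apply: cycle_pairs_respects; [lia|move=> a b /= ? ?; lia].
rewrite IH ?yE; [|lia|lia]; case: eqP; case: eqP; lia.
Qed.

(** A transposition of the last points of two consecutive intervals joins their cycles into one. *)
Lemma cycle_pairs_split c q m : 0 < q < m -> c + m <= N.+1 ->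
  prod_transp (cycle_pairs c m) =
  (transp (c + q).-1 (c + m).-1 *
   prod_transp (cycle_pairs c q ++ cycle_pairs (c + q) (m - q)))%g.
Proof.
elim: q m c => // q IH [|m] c; first by lia.
move=> qm cN; rewrite /= !prod_transp_cons /= subSS.
have -> : (c + m.+1).-1 = c + m by lia.
have -> : (c + q.+1).-1 = c + q by lia.
case: (posnP q) => [->|q0].
  rewrite /= /transp !addn0 tperm1 mul1g addn1 subn0 //.
rewrite (IH m); [|lia|lia].
have -> : (c.+1 + m).-1 = c + m by lia.
have -> : (c.+1 + q).-1 = c + q by lia.
have -> : c.+1 + q = c + q.+1 by lia.
rewrite !mulgA; congr (_ * _)%g.
(* Moved past the cutting transposition, the pair [(c, c + m)] becomes [(c, c + q)], the first pair
   of the left piece. *)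
by apply: transp_transp; lia.
Qed.

End TranspositionProducts.

(** * Binary trees and their chords *)

Inductive btree := Leaf | Join of btree & btree.

Fixpoint leaves t := if t is Join t1 t2 then leaves t1 + leaves t2 else 1.

(** Right ends of the chords at the leftmost leaf [lo]: they come from the nodes of the left spine,
    from bottom to top. *)
Fixpoint star lo t : seq nat :=
  if t is Join t1 t2 then rcons (star lo t1) (lo + leaves t).-1 else [::].

(** The chords that do not start at [lo]: each right subtree hanging from the left spine contributes
    all of its chords. *)
Fixpoint inner lo t : seq (nat * nat) :=
  if t is Join t1 t2 then
    let lo2 := lo + leaves t1 in
    inner lo t1 ++ [seq (lo2, b) | b <- star lo2 t2] ++ inner lo2 t2
  else [::].

Definition chords lo t := [seq (lo, b) | b <- star lo t] ++ inner lo t.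

Lemma leaves_gt0 t : 0 < leaves t.
Proof. by elim: t => //= t1 IH1 t2 IH2; lia. Qed.

Lemma chordsJ lo t1 t2 :
  chords lo (Join t1 t2) =
  [seq (lo, b) | b <- star lo t1] ++ (lo, (lo + leaves t1 + leaves t2).-1) ::
  inner lo t1 ++ chords (lo + leaves t1) t2.
Proof. by rewrite /chords /= map_rcons cat_rcons addnA. Qed.

Lemma size_chords lo t : size (chords lo t) = (leaves t).-1.
Proof.
elim: t lo => //= t1 IH1 t2 IH2 lo; have := IH1 lo.
rewrite chordsJ /chords !size_cat /= !size_cat /=.
have := IH2 (lo + leaves t1); rewrite /chords !size_cat !size_map.
by have := leaves_gt0 t1; have := leaves_gt0 t2; lia.
Qed.

Lemma star_bounds lo t : all (fun b => lo < b < lo + leaves t) (star lo t).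
Proof.
elim: t => //= t1 IH1 t2 _; rewrite all_rcons.
have ? := leaves_gt0 t1; have ? := leaves_gt0 t2.
apply/andP; split; first by lia.
by apply: sub_all IH1 => b /=; lia.
Qed.

Lemma inner_bounds lo t :
  all (fun e => [&& lo < e.1, e.1 < e.2 & e.2 < lo + leaves t]) (inner lo t).
Proof.
elim: t lo => //= t1 IH1 t2 IH2 lo.
have ? := leaves_gt0 t1; have ? := leaves_gt0 t2.
rewrite !all_cat all_map; apply/and3P; split.
- by apply: sub_all (IH1 lo) => e /=; lia.
- by apply: sub_all (star_bounds (lo + leaves t1) t2) => b /=; lia.
- by apply: sub_all (IH2 (lo + leaves t1)) => e /=; lia.
Qed.

Lemma chords_bounds lo t :
  all (fun e => [&& lo <= e.1, e.1 < e.2 & e.2 < lo + leaves t]) (chords lo t).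
Proof.
have ? := leaves_gt0 t.
rewrite all_cat all_map; apply/andP; split.
- by apply: sub_all (star_bounds lo t) => b /=; lia.
- by apply: sub_all (inner_bounds lo t) => e /=; lia.
Qed.

Definition lexi (e e' : nat * nat) :=
  (e.1 < e'.1) || (e.1 == e'.1) && (e.2 < e'.2).

Lemma allrel_all (T T' : Type) (r : T -> T' -> bool) (p : pred T) (q : pred T') s s' :
  (forall x y, p x -> q y -> r x y) -> all p s -> all q s' -> allrel r s s'.
Proof.
move=> pqr; elim: s => //= x s IH /andP[px ps] qs'.
by rewrite allrel_consl IH // andbT; apply: sub_all qs' => y; apply: pqr.
Qed.

Lemma pairwise_star lo t : pairwise ltn (star lo t).
Proof.
elim: t => //= t1 IH1 t2 _; rewrite pairwise_rcons IH1 andbT.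
have ? := leaves_gt0 t2.
by apply: sub_all (star_bounds lo t1) => b /=; lia.
Qed.

(** The inner chords of [t1] end before the first leaf of [t2], where the chords of [t2] begin. The
    strict order gives both monotonicity and distinctness. *)
Lemma pairwise_chords lo t : pairwise lexi (chords lo t).
Proof.
have star_lexi lo' t' : pairwise lexi [seq (lo', b) | b <- star lo' t'].
  rewrite pairwise_map; apply: sub_pairwise (pairwise_star lo' t').
  by move=> a b; rewrite /lexi /=; lia.
suff inner_lexi : pairwise lexi (inner lo t).
  rewrite pairwise_cat star_lexi inner_lexi !andbT.
  apply: (@allrel_all _ _ _ (fun e => e.1 == lo) _ _ _ _ _ (inner_bounds lo t)).
    by move=> e e' /=; rewrite /lexi; lia.
  by rewrite all_map; apply/allP => b _ /=.
elim: t lo => //= t1 IH1 t2 IH2 lo.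
rewrite !pairwise_cat IH1 IH2 star_lexi !andbT /=.
have ? := leaves_gt0 t1.
apply/andP; split.
  apply: (@allrel_all _ _ _ _ _ _ _ _ (inner_bounds lo t1)); last first.
    exact: (chords_bounds (lo + leaves t1) t2).
  by move=> e e' /=; rewrite /lexi; lia.
apply: (@allrel_all _ _ _ (fun e => e.1 == lo + leaves t1) _ _ _ _ _ (inner_bounds _ t2)).
  by move=> e e' /=; rewrite /lexi; lia.
by rewrite all_map; apply/allP => b _ /=.
Qed.

(** * Products of chords, and recovery of a forest from a factorisation *)

Section Products.

Variable N : nat.
Local Notation P := (@prod_transp N).
Local Notation T := (@transp N).

(** By induction the two subtrees give the cycles on their intervals, and the chord of the root
    joins them as in [cycle_pairs_split]. *)
Lemma prod_chords lo t : lo + leaves t <= N.+1 ->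
  P (chords lo t) = P (cycle_pairs lo (leaves t)).
Proof.
elim: t lo => [|t1 IH1 t2 IH2] lo loN.
  by rewrite /= prod_transp_cons prod_transp_nil /transp addn0 tperm1 mulg1.
have ? := leaves_gt0 t1; have ? := leaves_gt0 t2; rewrite /= in loN.
rewrite (@cycle_pairs_split _ _ (leaves t1)) /=; [|lia|lia].
rewrite addKn prod_transp_cat -IH1; [|lia]; rewrite -IH2; [|lia].
rewrite chordsJ prod_transp_cat prod_transp_cons /= prod_transp_cat.
rewrite !mulgA; congr (_ * _)%g.
have inner_fix a : (a <= lo) || (lo + leaves t1 <= a) -> respects N (pred1 a) (inner lo t1).
  by move=> alo; apply: sub_all (inner_bounds lo t1) => e /=; lia.
(* Both ends of the root chord are fixed by the inner chords of [t1], so it can be moved after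
   them. *)
rewrite -mulgA -transp_comm; [|lia|lia|apply: inner_fix; lia|apply: inner_fix; lia].
rewrite mulgA -prod_transp_cat -/(chords lo t1) IH1; last by lia.

have hiE : (lo + leaves t1 + leaves t2).-1 = (lo + (leaves t1 + leaves t2)).-1 by lia.
(* The cycle on the leaves of [t1] fixes [hi] and sends the last leaf of [t1] to [lo], so
   conjugation turns the cutting transposition into the root chord. *)
rewrite [RHS]conjgC /transp tpermJ hiE; set hi : 'I_N.+1 := inord _.-1.
rewrite [P _ hi]prod_transp_fix; last first.
  by apply: cycle_pairs_respects => [|a b /= ? ?]; rewrite ?inordE; lia.
congr (_ * tperm _ _)%g; apply/val_inj.
by rewrite /= cycle_pairsE ?inordE; try lia; case: eqP; lia.
Qed.

Fixpoint block_cycles lo ms : seq (nat * nat) :=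
  if ms is m :: ms' then cycle_pairs lo m ++ block_cycles (lo + m) ms' else [::].

Fixpoint block_ends lo ms : seq nat :=
  if ms is m :: ms' then (lo + m).-1 :: block_ends (lo + m) ms' else [::].

Fixpoint forest_chords lo ts : seq (nat * nat) :=
  if ts is t :: ts' then chords lo t ++ forest_chords (lo + leaves t) ts' else [::].

Lemma block_cycles_cat lo ms1 ms2 : block_cycles lo (ms1 ++ ms2) =
  block_cycles lo ms1 ++ block_cycles (lo + sumn ms1) ms2.
Proof.
elim: ms1 lo => /= [|m ms1 IH] lo; first by rewrite addn0.
by rewrite IH catA addnA.
Qed.

Lemma forest_chords_cat lo ts1 ts2 : forest_chords lo (ts1 ++ ts2) =
  forest_chords lo ts1 ++ forest_chords (lo + sumn (map leaves ts1)) ts2.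
Proof.
elim: ts1 lo => /= [|t ts1 IH] lo; first by rewrite addn0.
by rewrite IH catA addnA.
Qed.

Lemma block_ends_rcons lo ms m : block_ends lo (rcons ms m) =
  rcons (block_ends lo ms) (lo + sumn ms + m).-1.
Proof. by elim: ms lo => /= [|k ms IH] lo; rewrite ?addn0 // IH addnA. Qed.

(** The left fold hangs the trees of [ts] from a left spine whose bottom is the leaf [lo]. It
    reassembles the pieces cut from the cycle of [lo]. *)
Lemma chords_foldl_Join lo ts :
  let t := foldl Join Leaf ts in
  [/\ leaves t = (sumn (map leaves ts)).+1,
      star lo t = block_ends lo.+1 (map leaves ts) &
      inner lo t = forest_chords lo.+1 ts].
Proof.
elim/last_ind: ts => //= ts t [IHl IHs IHi].
rewrite foldl_rcons /= map_rcons IHl IHs IHi block_ends_rcons sumn_rcons.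
split=> //; first by congr rcons; lia.
by rewrite -cats1 forest_chords_cat /= cats0 addSn addnS.
Qed.

Lemma block_cycles_respects (X : pred nat) lo ms : lo + sumn ms <= N.+1 ->
  (forall a b, lo <= a < lo + sumn ms -> lo <= b < lo + sumn ms -> X a = X b) ->
  respects N X (block_cycles lo ms).
Proof.
elim: ms lo => //= m ms IH lo loN Xlo.
rewrite /respects all_cat; apply/andP; split.
  by apply: cycle_pairs_respects => [|a b ? ?]; [lia | apply: Xlo; lia].
by apply: IH => [|a b ? ?]; [lia | apply: Xlo; lia].
Qed.

(** The cutting transposition of one block commutes with the cycles of the earlier blocks, which are
    disjoint from it. *)
Lemma block_cycles_split lo qs q m ms :
  0 < q < m -> lo + sumn (qs ++ m :: ms) <= N.+1 ->
  P (block_cycles lo (qs ++ m :: ms)) =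
  (T (lo + sumn qs + q).-1 (lo + sumn qs + m).-1 *
   P (block_cycles lo (qs ++ q :: m - q :: ms)))%g.
Proof.
rewrite sumn_cat /= => qm loN.
rewrite !block_cycles_cat /= !prod_transp_cat.
rewrite (@cycle_pairs_split _ _ q) ?prod_transp_cat //; last by lia.
have -> : lo + sumn qs + q + (m - q) = lo + sumn qs + m by lia.
rewrite !mulgA; congr (_ * _ * _ * _)%g.
apply: transp_comm; [lia | lia | |];
  by apply: block_cycles_respects => [|a b /= ? ?]; lia.
Qed.

Definition minimal_increasing lo s :=
  [&& minimal N s, pairwise leq (unzip1 s)
    & all (fun e => [&& lo <= e.1, e.1 < e.2 & e.2 <= N]) s].

Lemma minimal_increasing_behead lo e s : minimal_increasing lo (e :: s) ->
  minimal_increasing lo s.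
Proof.
by case: e => a b /and3P[/minimal_cons ms /andP[_ ps] /andP[_ hs]]; apply/and3P.
Qed.

Lemma minimal_increasing_fix lo s : minimal_increasing lo.+1 s -> lo <= N ->
  P s (inord lo) = inord lo.
Proof.
move=> /and3P[_ _ hs] loN; apply: prod_transp_fix.
by apply: sub_all hs => e; rewrite /= inordE //; lia.
Qed.

(** If the first pair started at [lo], minimality would put its other point on the cycle of [lo],
    which is trivial. The later pairs start no earlier. *)
Lemma fix_minimal_increasing lo s : minimal_increasing lo s -> lo <= N ->
  P s (inord lo) = inord lo ->
  minimal_increasing lo.+1 s.
Proof.
case: s => [|[a b] s] // /and3P[min_s ps hs] loN fix_lo.
apply/and3P; split=> //.
have /= /andP[/and3P[lo_a ab bN] _] := hs.
have {}lo_a : lo < a.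
  rewrite ltn_neqAle lo_a andbT; apply/eqP => ela; rewrite -ela in min_s fix_lo.
  have /porbitP[i] := minimal_porbit min_s.
  by move/eqP; rewrite permX_fix // eq_inord //; lia.
rewrite /= lo_a ab bN /=; have /= /andP[/allP a_le _] := ps.
have /= /andP[_ /allP hs'] := hs; apply/allP => e es.
by have := hs' e es; have := a_le e.1 (map_f fst es) => /=; lia.
Qed.

(** State after the blocks [qs] have been cut off: the cycle of [lo] consists of [lo] and the block
    of size [m]. The pairs at [lo] that remain cut this block from left to right into [qs']. *)
Lemma star_step lo s qs m ms : 0 < m -> lo + sumn (qs ++ m :: ms) = N ->
  minimal_increasing lo s ->
  P s = (T lo (lo + sumn qs + m) * P (block_cycles lo.+1 (qs ++ m :: ms)))%g ->
  exists qs' s', [/\ all (leq 1) qs' /\ sumn qs' = m,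
    s = [seq (lo, b) | b <- block_ends (lo.+1 + sumn qs) qs'] ++ s',
    P s' = P (block_cycles lo.+1 (qs ++ qs' ++ ms)) & minimal_increasing lo.+1 s'].
Proof.
elim: s qs m => [|[a b] s IH] qs m m0 sumN good_s Ps.
all: have [sumN' loN] : lo + sumn qs + m + sumn ms = N /\ lo <= N
  by move: sumN; rewrite sumn_cat /=; lia.
all: have fix_lo : P (block_cycles lo.+1 (qs ++ m :: ms)) (inord lo) = inord lo
  by apply: prod_transp_fix; apply: block_cycles_respects => [|x y /= ? ?];
     rewrite ?inordE; lia.
all: have not_fix :
    (T lo (lo + sumn qs + m) * P (block_cycles lo.+1 (qs ++ m :: ms)))%g (inord lo)
    <> inord lo
  by rewrite -{2}fix_lo permM /transp tpermL => /perm_inj/eqP;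
     rewrite eq_inord; lia.
all: rewrite -Ps in not_fix.
  by case: not_fix; rewrite prod_transp_nil perm1.
(* Otherwise all pairs lie above [lo], and the product fixes [lo]. *)
have eal : a = lo.
  have /and3P[min_s ps /andP[/and3P[loa ab bN] hs]] := good_s.
  apply/eqP; rewrite eq_sym eqn_leq loa leqNgt; apply/negP => lt_lo.
  apply: not_fix; apply: minimal_increasing_fix => //; apply/and3P; split=> //.
  rewrite /= lt_lo ab bN /=; have /= /andP[/allP a_le _] := ps.
  apply/allP => e es.
  by have := allP hs e es; have := a_le e.1 (map_f fst es) => /=; lia.
rewrite {a}eal in good_s Ps not_fix *.
have /and3P[min_s _ /andP[/and3P[_ /= lob bN] _]] := good_s.
set c := lo.+1 + sumn qs.
have /andP[cb bhi] : c <= b <= lo + sumn qs + m.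
  (* [X] is the cycle of [lo] in the product; by minimality it contains [b]. *)
  pose X (x : nat) := (x == lo) || (c <= x <= lo + sumn qs + m).
  suff : X b = X lo by rewrite /X; lia.
  rewrite -[b](@inordE N) // -[in RHS](@inordE N lo) //.
  have X_D lo' ms' : lo' + sumn ms' <= N.+1 ->
      (lo < lo') && ((lo' + sumn ms' <= c) || (c + m <= lo')) ->
      respects N X (block_cycles lo' ms').
    by move=> h1 h2; apply: block_cycles_respects => // x y; rewrite /X; lia.
  have := minimal_porbit min_s.
  rewrite Ps -(prod_transp_cons N (lo, lo + sumn qs + m)) => b_lo.
  refine (porbit_respects (X := X) _ b_lo); rewrite /respects /=; apply/andP.
  split; first by rewrite /X /=; lia.
  rewrite block_cycles_cat all_cat /= all_cat; apply/and3P; split.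
  - by apply: X_D; lia.
  - by apply: cycle_pairs_respects => [|x y ? ?]; rewrite /X; lia.
  - by apply: X_D; lia.
have Ps1 : P s = (T lo b * P ((lo, b) :: s))%g.
  by rewrite prod_transp_cons mulgA /transp tperm2 mul1g.
have good_s1 := minimal_increasing_behead good_s.
(* A chord that reaches the end of the block detaches [lo], and the block is the last piece. A
   shorter one cuts off the points from [c] to [b]. *)
move: bhi; rewrite leq_eqVlt => /orP[/eqP ebhi|bhi].
  exists [:: m], s; have {}Ps1 : P s = P (block_cycles lo.+1 (qs ++ [:: m] ++ ms)).
    by rewrite Ps1 Ps ebhi mulgA /transp tperm2 mul1g.
  split=> //; first by rewrite /= m0 addn0.
    by rewrite /= ebhi /c; congr ((_, _) :: _); lia.
  by apply: fix_minimal_increasing => //; rewrite Ps1.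
have [q qE] : exists q, q = b.+1 - c by eexists.
have qm : 0 < q < m by rewrite qE /c; lia.
have [||||qs' [s' [[qs'0 sum_qs'] sE Ps' good_s']]] := IH (rcons qs q) (m - q).
- by lia.
- by rewrite cat_rcons sumn_cat /=; lia.
- by [].
- rewrite Ps1 Ps (@block_cycles_split _ _ q) //; last by lia.
  have -> : (lo.+1 + sumn qs + q).-1 = b by lia.
  have -> : (lo.+1 + sumn qs + m).-1 = lo + sumn qs + m by lia.
  have -> : lo + sumn (rcons qs q) + (m - q) = lo + sumn qs + m.
    by rewrite sumn_rcons; lia.
  (* With [h] the end of the block, the transpositions [(lo b)], [(lo h)], [(b h)] multiply to
     [(lo h)]: the cycle of [lo] now passes through the last [m - q] points. *)
  rewrite cat_rcons !mulgA; congr (_ * _)%g; rewrite -!mulgA.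
  rewrite transp_transp; [|lia..].
  by rewrite [X in (_ * X)%g]conjgC mulgA /transp tperm2 mul1g tpermJ tpermR tpermD
       ?eq_inord //; lia.
exists (q :: qs'), s'; split=> //.
- by rewrite /= qs'0 sum_qs'; split; lia.
- rewrite sE sumn_rcons /=; congr ((_, _) :: _); [lia|].
  by congr (map _ (block_ends _ _) ++ _); lia.
- by rewrite Ps' cat_rcons.
Qed.

(** Induction on the number of points left: [star_step] removes the pairs at [lo], and the pieces of
    its cycle become blocks starting at [lo.+1]. *)
Lemma minimal_increasing_forest lo ms s : lo + sumn ms = N.+1 -> all (leq 1) ms ->
  minimal_increasing lo s ->
  P s = P (block_cycles lo ms) ->
  exists2 ts, map leaves ts = ms & s = forest_chords lo ts.
Proof.
have [k] := ubnP (N.+1 - lo); elim: k lo ms s => // k IH lo [|[|m] ms] s //= lok.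
  rewrite addn0 => loN _ /and3P[_ _ hs] _; exists [::] => //=.
  by case: s hs => // e s /= /andP[]; lia.
move=> sumN ms0 good_s Ps; have loN : lo <= N by lia.
case: (posnP m) => [m0|m0].
  rewrite m0 /= in Ps sumN.
  have {}Ps : P s = P (block_cycles lo.+1 ms).
    by rewrite Ps prod_transp_cons /= addn0 /transp tperm1 mul1g addn1.
  have [|||||ts tsE sE] := IH lo.+1 ms s; try by [].
  - by lia.
  - by lia.
  - apply: fix_minimal_increasing => //; rewrite Ps prod_transp_fix //.
    by apply: block_cycles_respects => [|a b /= ? ?]; rewrite ?inordE; lia.
  by exists (Leaf :: ts); rewrite /= ?m0 ?tsE ?sE ?addn1.
have sumN' : lo + sumn ([::] ++ m :: ms) = N by rewrite /=; lia.
have [|qs [s' [[qs0 sum_qs] sE Ps' good_s']]] := star_step m0 sumN' good_s.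
  by rewrite Ps /= prod_transp_cons /= addn0 addnS addSn.
have [|||||ts tsE s'E] := IH lo.+1 (qs ++ ms) s'; try by [].
- by lia.
- by rewrite sumn_cat; lia.
- by rewrite all_cat qs0.
(* The trees [ts1] stand on the pieces of the cycle of [lo] and are gathered into one tree; [ts2]
   stands on the other blocks. *)
pose ts1 := take (size qs) ts; pose ts2 := drop (size qs) ts.
have ts1E : map leaves ts1 = qs by rewrite map_take tsE take_size_cat.
have ts2E : map leaves ts2 = ms by rewrite map_drop tsE drop_size_cat.
have /= [tl tst tin] := chords_foldl_Join lo ts1.
exists (foldl Join Leaf ts1 :: ts2); rewrite /= ?ts2E ?tl ts1E ?sum_qs //.
rewrite sE s'E /chords tst tin -[in LHS](cat_take_drop (size qs) ts).
rewrite forest_chords_cat ts1E sum_qs catA addSn addnS.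
by rewrite /= addn0.
Qed.

Lemma nb_cycles_long_cycle : nb_cycles (long_cycle N.+1) = 1.
Proof.
apply/eqP; rewrite eqn_leq; apply/andP; split; last first.
  rewrite /nb_cycles; apply/card_gt0P.
  by exists (porbit (long_cycle N.+1) ord0); apply: imset_f.
have orbit0 (x : 'I_N.+1) : x \in porbit (long_cycle N.+1) ord0.
  apply/porbitP; exists (val x); case: x => x xN /=; apply/val_inj => /=.
  elim: x xN => [|x IHx] xN; first by rewrite expg0 perm1.
  by rewrite expgSr permM permE /= -IHx ?modn_small //; lia.
rewrite /nb_cycles -(cards1 (porbit (long_cycle N.+1) ord0)).
apply/subset_leq_card/fintype.subsetP.
move=> A /imsetP[x _ ->]; rewrite finset.in_set1 eq_sym eq_porbit_mem porbit_sym.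
exact: orbit0.
Qed.

Lemma prod_cycle_pairs_long_cycle : P (cycle_pairs 0 N.+1) = long_cycle N.+1.
Proof.
apply/permP => x; apply: ord_inj; rewrite cycle_pairsE ?add0n ?ltn_ord // /long_cycle permE /=.
have := ltn_ord x; case: eqP => [->|]; first by rewrite modnn.
by move=> ? ?; rewrite modn_small; lia.
Qed.


End Products.

(** * Correspondence between binary trees and plane trees *)

Fixpoint low_children t : seq plane_tree :=
  if t is Join t1 t2 then rcons (low_children t1) (PNode (high_children t2))
  else [::]
with high_children t : seq plane_tree :=
  if t is Join t1 t2 then PNode (low_children t1) :: high_children t2
  else [::].

Lemma nb_vertices_children t :
  nb_vertices (PNode (low_children t)) = leaves t /\
  nb_vertices (PNode (high_children t)) = leaves t.
Proof.
elim: t => //= t1 [IHl1 IHh1] t2 [IHl2 IHh2].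
by rewrite map_rcons sumn_rcons /= -IHl1 -IHh2 /=; split; lia.
Qed.

(** The last low child determines [t2] and the others [t1]; the first high child determines [t1] and
    the others [t2]. The two claims need each other. *)
Lemma children_inj : injective low_children /\ injective high_children.
Proof.
suff inj t u : (low_children t = low_children u -> t = u) /\
               (high_children t = high_children u -> t = u).
  by split=> t u; apply inj.
elim: t u => [|t1 IH1 t2 IH2] [|u1 u2] //=; first by split=> //; case: low_children.
  by split=> //; case: low_children.
have [l1 h1] := IH1 u1; have [l2 h2] := IH2 u2.
by split=> [/rcons_inj[/l1 -> /h2 ->]|[/l1 -> /h2 ->]].
Qed.

Lemma nb_vertices_PNode us : nb_vertices (PNode us) = (sumn (map nb_vertices us)).+1.
Proof. by []. Qed.

(** Joint induction on the number of vertices, removing the last child for [low_children] and the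
    first for [high_children]. *)
Lemma children_surj ts :
  (exists t, low_children t = ts) /\ (exists t, high_children t = ts).
Proof.
have [k] := ubnP (sumn (map nb_vertices ts)); elim: k ts => // k IH ts tsk.
split.
  case/lastP: ts tsk => [|ts [us]] tsk; first by exists Leaf.
  rewrite map_rcons sumn_rcons nb_vertices_PNode in tsk.
  have [|[t1 <-] _] := IH ts; first by lia.
  have [|_ [t2 <-]] := IH us; first by lia.
  by exists (Join t1 t2).
case: ts tsk => [|[us] ts] tsk; first by exists Leaf.
have {}tsk : nb_vertices (PNode us) + sumn (map nb_vertices ts) < k.+1 := tsk.
rewrite nb_vertices_PNode in tsk.
have [|[t1 <-] _] := IH us; first by lia.
have [|_ [t2 <-]] := IH ts; first by lia.
by exists (Join t1 t2).
Qed.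

(** * Exploration of the graph of chords *)

Definition other_end (v : nat) (e : nat * nat) : seq nat :=
  if e.1 == v then [:: e.2] else if e.2 == v then [:: e.1] else [::].

Definition neighbours s v := flatten [seq other_end v e | e <- s].

(** Counterpart of [subtree_at] on pairs of naturals, with the parent given as a vertex instead of
    an edge label. *)
Fixpoint explore m s (p : option nat) v : plane_tree :=
  if m is m'.+1 then
    PNode [seq explore m' s (Some v) w | w <- neighbours s v & Some w != p]
  else PNode [::].

Lemma neighbours_cat s1 s2 v :
  neighbours (s1 ++ s2) v = neighbours s1 v ++ neighbours s2 v.
Proof. by rewrite /neighbours map_cat flatten_cat. Qed.

Lemma neighbours_cons e s v : neighbours (e :: s) v = other_end v e ++ neighbours s v.
Proof. by []. Qed.

Lemma neighbours_nil s v : all (fun e => (e.1 != v) && (e.2 != v)) s ->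
  neighbours s v = [::].
Proof.
elim: s => //= e s IH /andP[/andP[/negPf e1 /negPf e2] /IH].
by rewrite neighbours_cons /other_end e1 e2.
Qed.

Lemma neighbours_star lo l : neighbours [seq (lo, b) | b <- l] lo = l.
Proof. by elim: l => //= b l IH; rewrite neighbours_cons IH /other_end /= eqxx. Qed.

Lemma all_neighbours (p : pred nat) s v :
  all (fun e => p e.1 && p e.2) s -> all p (neighbours s v).
Proof.
elim: s => //= e s IH /andP[/andP[p1 p2] /IH ps].
rewrite neighbours_cons all_cat ps andbT /other_end.
by case: ifP => _ /=; [rewrite p2 | case: ifP => _ //=; rewrite p1].
Qed.

Lemma neighbours_inner lo t v : (v <= lo) || (lo + leaves t <= v) ->
  neighbours (inner lo t) v = [::].
Proof.
by move=> vlo; apply: neighbours_nil; apply: sub_all (inner_bounds lo t) => e /=; lia.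
Qed.

Lemma neighbours_chords lo t v : (v < lo) || (lo + leaves t <= v) ->
  neighbours (chords lo t) v = [::].
Proof.
by move=> vlo; apply: neighbours_nil; apply: sub_all (chords_bounds lo t) => e /=; lia.
Qed.

Lemma neighbours_chords_low lo t : neighbours (chords lo t) lo = star lo t.
Proof.
by rewrite neighbours_cat neighbours_star neighbours_inner ?leqnn // cats0.
Qed.

Lemma neighbours_chordsJ1 lo t1 t2 v : lo < v < lo + leaves t1 ->
  neighbours (chords lo (Join t1 t2)) v = neighbours (chords lo t1) v.
Proof.
have ? := leaves_gt0 t2; move=> vlo.
rewrite chordsJ /chords !neighbours_cat neighbours_cons neighbours_cat.
rewrite [neighbours (chords _ _) _]neighbours_chords ?cats0; last by lia.
rewrite /other_end /=; case: eqP => [|_]; first by lia.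
by case: eqP => [|_] //; lia.
Qed.

Lemma neighbours_chordsJ2 lo t1 t2 v :
  lo + leaves t1 <= v < lo + leaves t1 + leaves t2 ->
  neighbours (chords lo (Join t1 t2)) v =
  nseq (v == (lo + leaves t1 + leaves t2).-1) lo
  ++ neighbours (chords (lo + leaves t1) t2) v.
Proof.
have ? := leaves_gt0 t1; move=> vlo.
rewrite chordsJ !neighbours_cat neighbours_cons neighbours_cat.
rewrite neighbours_nil; last first.
  by rewrite all_map; apply: sub_all (star_bounds lo t1) => b /=; lia.
rewrite neighbours_inner /=; last by lia.
rewrite /other_end /= (eq_sym v).
rewrite /chords neighbours_cat; case: eqP => [|_]; first by lia.
by case: eqP.
Qed.

(** In a larger graph [s], the chords of [t] may be attached to the rest at [lo] in the first claim
    and at [hi] in the second; the neighbours of that vertex in [s] are left free. *)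
Lemma explore_chords lo t s m : leaves t <= m.+1 ->
  ((forall v, lo < v < lo + leaves t -> neighbours s v = neighbours (chords lo t) v) ->
   map (explore m s (Some lo)) (star lo t) = low_children t) /\
  (let hi := (lo + leaves t).-1 in
   (forall v, lo <= v < hi -> neighbours s v = neighbours (chords lo t) v) ->
   map (explore m s (Some hi)) (neighbours (chords lo t) hi) = high_children t).
Proof.
elim: t lo m => [|t1 IH1 t2 IH2] lo m /= tm.
  by split=> // _; rewrite addn1 /= neighbours_chords_low.
have l1 := leaves_gt0 t1; have l2 := leaves_gt0 t2.
rewrite addnA; set lo2 := lo + leaves t1; set hi := (lo2 + leaves t2).-1.
case: m tm => [|m] tm; first by lia.
have nb_hi : neighbours (chords lo (Join t1 t2)) hi = lo :: neighbours (chords lo2 t2) hi.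
  by rewrite neighbours_chordsJ2 ?eqxx //; rewrite /hi /lo2; lia.
have nb_J2 v : lo2 <= v < hi ->
    neighbours (chords lo (Join t1 t2)) v = neighbours (chords lo2 t2) v.
  move=> v2; rewrite neighbours_chordsJ2 -/lo2 -/hi; last by rewrite /hi in v2; lia.
  by case: eqP => // ?; lia.
split=> nb_s.
  rewrite map_rcons (IH1 lo m.+1 _).1; [|lia|]; last first.
    by move=> v v1; rewrite nb_s ?neighbours_chordsJ1 // /lo2; lia.
  congr rcons; rewrite /= nb_s; last by rewrite /hi /lo2; lia.
  rewrite nb_hi /= eqxx /=; congr PNode.
  (* Only the parent [lo] is discarded at [hi]: the other neighbours are leaves of [t2]. *)
  rewrite (all_filterP _); last first.
    have : all (leq lo2) (neighbours (chords lo2 t2) hi).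
      by apply: all_neighbours; apply: sub_all (chords_bounds lo2 t2) => e /=; lia.
    by apply: sub_all => w; rewrite /lo2 => ?; apply/eqP => -[]; lia.
  apply: (IH2 lo2 m _).2; first by lia.
  by move=> v v2; rewrite nb_s ?nb_J2 //; rewrite /hi /lo2 in v2 *; lia.
rewrite nb_hi map_cons; congr cons; last first.
  apply: (IH2 lo2 m.+1 _).2; first by lia.
  by move=> v v2; rewrite nb_s ?nb_J2 //; rewrite /hi /lo2 in v2 *; lia.
rewrite /= nb_s; last by rewrite /hi /lo2; lia.
(* Seen from [hi], the vertex [lo] loses the last point of its star, the parent [hi], and keeps the
   star of [t1]. *)
rewrite neighbours_chords_low /= addnA -/lo2 -/hi filter_rcons eqxx /=.
rewrite (all_filterP _); last first.
  by apply: sub_all (star_bounds lo t1) => w ?; apply/eqP => -[]; rewrite /hi /lo2; lia.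
congr PNode; apply: (IH1 lo m _).1; first by lia.
by move=> v v1; rewrite nb_s ?neighbours_chordsJ1 // /hi /lo2; lia.
Qed.

(** * Passage between lists of pairs and tuples of permutations *)

Section Factorisations.

Variable N : nat.
Local Notation P := (@prod_transp N).
Local Notation T := (@transp N).
Implicit Types (f : N.+1.-1.-tuple 'S_N.+1) (s : seq (nat * nat)).

Definition represents s f := tval f = [seq T e.1 e.2 | e <- s].

Definition ordered_pairs s := all (fun e => (e.1 < e.2) && (e.2 <= N)) s.

Lemma transp_inj a b c d : a < b -> b <= N -> c < d -> d <= N ->
  T a b = T c d -> (a, b) = (c, d).
Proof.
move=> ab bN cd dN eT.
have Ta : T a b (inord a) = b :> nat by rewrite transpE ?inordE ?eqxx; lia.
have Tb : T a b (inord b) = a :> nat by rewrite transpE ?inordE ?eqxx; [case: eqP|..]; lia.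
move: Ta Tb; rewrite eT !transpE ?inordE; try lia.
by do 4?case: eqP => /=; intros; congr pair; lia.
Qed.

Section Represented.

Variables (f : N.+1.-1.-tuple 'S_N.+1) (s : seq (nat * nat)).
Hypotheses (sf : represents s f) (s_ord : ordered_pairs s).

Lemma size_represents : size s = N.
Proof. by rewrite -(size_map (fun e => T e.1 e.2)) -sf size_tuple. Qed.

Let e_ (k : 'I_N) := nth (0, 0) s k.

Lemma tnth_represents (k : 'I_N) : tnth f k = T (e_ k).1 (e_ k).2.
Proof.
by rewrite (tnth_nth 1%g) sf (nth_map (0, 0)) // size_represents.
Qed.

Lemma pair_represents (k : 'I_N) : ((e_ k).1 < (e_ k).2) && ((e_ k).2 <= N).
Proof. by apply: (allP s_ord); apply: mem_nth; rewrite size_represents. Qed.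

Lemma prod_represents : (\prod_(k < N.+1.-1) tnth f k)%g = P s.
Proof. by rewrite -(big_tuple _ _ f xpredT id) sf big_map. Qed.

Lemma represents_tperm (k : 'I_N) (a b : 'I_N.+1) :
  a < b -> (tnth f k == tperm a b) = (e_ k == (a : nat, b : nat)).
Proof.
move=> ab; rewrite tnth_represents; have /andP[lt_e leN] := pair_represents k.
have -> : tperm a b = T a b by rewrite /transp !inord_val.
apply/eqP/eqP => [eT|->] //; rewrite [LHS]surjective_pairing.
by apply: transp_inj eT; rewrite // -ltnS ltn_ord.
Qed.

Lemma edge_represents (k : 'I_N) (v w : 'I_N.+1) :
  edge f k v w = (v != w) && (e_ k == (minn v w, maxn v w)).
Proof.
rewrite /edge; case: (ltngtP v w) => [vw|wv|/val_inj->]; last by rewrite eqxx.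
  by rewrite represents_tperm.
by rewrite tpermC represents_tperm.
Qed.

(** Each label gives at most one neighbour of [v], so both sides have at most one element. *)
Lemma other_end_represents (k : 'I_N) (v : 'I_N.+1) :
  other_end v (e_ k) = [seq val w | w <- enum 'I_N.+1 & edge f k v w].
Proof.
have /andP[lt_e leN] := pair_represents k.
rewrite (eq_filter (edge_represents k v)) /other_end.
case: (e_ k) lt_e leN => a b /= ab bN.
have enum1 (c : nat) : c <= N -> [:: c] = [seq val w | w <- enum 'I_N.+1 & w == inord c].
  by move=> cN; rewrite filter_pred1_uniq ?enum_uniq ?mem_enum //= inordE.
case: eqP => [av|av].
  rewrite (enum1 b bN); congr map; apply: eq_filter => w.
  by rewrite -!val_eqE /= inordE // xpair_eqE; lia.
case: eqP => [bv|bv].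
  rewrite (enum1 a); last by lia.
  congr map; apply: eq_filter => w.
  by rewrite -!val_eqE /= inordE ?xpair_eqE; lia.
rewrite (eq_filter (a2 := pred0)) ?filter_pred0 // => w /=.
by rewrite xpair_eqE; lia.
Qed.

(** Relates the parent edge used by [subtree_at] to the parent vertex used by [explore]. *)
Definition same_parent v (p : option 'I_N) (p' : option nat) : Prop :=
  match p, p' with
  | None, None => True
  | Some k, Some u => exists2 u' : 'I_N.+1, u = u' & edge f k v u'
  | _, _ => False
  end.

Hypothesis s_uniq : uniq s.

Lemma stemming_edges_represents (p : option 'I_N) p' (v : 'I_N.+1) :
  same_parent v p p' ->
  [seq val e.2 | e <- stemming_edges f p v] =
  [seq w <- neighbours s v | Some w != p'].
Proof.
move=> pp'; rewrite /stemming_edges /neighbours.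
have <- : [seq e_ k | k <- enum 'I_N] = s.
  by rewrite -[RHS](mkseq_nth (0, 0)) size_represents /mkseq -val_enum_ord -map_comp.
rewrite !filter_flatten map_flatten -!map_comp; congr flatten; apply: eq_map => k /=.
rewrite filter_map -map_comp /=.
rewrite other_end_represents filter_map; congr map; rewrite -[RHS]filter_predI.
apply: eq_filter => w /=; case vw : (edge f k v w); rewrite ?andbF // !andbT.
move: vw; rewrite edge_represents => /andP[vw /eqP ekE].
case: p p' pp' => [k0|] [u|] //= [u' ->]; rewrite edge_represents => /andP[vu /eqP ek0E].
(* Equal labels give equal other ends at [v]; conversely, equal ends give equal pairs, hence equal
   labels as [s] has no repetition. *)
rewrite /eq_op /=; congr negb; apply/eqP/eqP => [ekk0|ewu].
  by move: ek0E vu vw; rewrite -ekk0 ekE => -[? ?]; rewrite -!val_eqE /=; lia.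
apply/val_inj/eqP; rewrite /= -(nth_uniq (0, 0) _ _ s_uniq) ?size_represents //.
by rewrite -/(e_ k) -/(e_ k0) ekE ek0E ewu.
Qed.

Lemma forget_subtree_at m p p' (v : 'I_N.+1) : same_parent v p p' ->
  forget_labels (subtree_at m f p v) = explore m s p' v.
Proof.
elim: m p p' v => //= m IH p p' v pp'.
rewrite -map_comp -(stemming_edges_represents pp') -map_comp; congr PNode.
apply/eq_in_map => -[k w]; rewrite mem_filter /= => /andP[/andP[_ vw] _].
by apply: IH; exists v; rewrite // /edge eq_sym tpermC.
Qed.

End Represented.

Lemma chords_ordered t : leaves t = N.+1 -> ordered_pairs (chords 0 t).
Proof. by move=> tN; apply: sub_all (chords_bounds 0 t) => e /=; lia. Qed.

Lemma lexi_uniq s : pairwise lexi s -> uniq s.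
Proof.
rewrite uniq_pairwise; apply: sub_pairwise => e e'; rewrite /lexi.
by apply: contraTneq => ->; lia.
Qed.

Lemma T3_represents (hn : 2 <= N.+1) f t : leaves t = N.+1 ->
  represents (chords 0 t) f -> T3 hn f = PNode (low_children t).
Proof.
move=> tN ft; rewrite /T3 /T1.
have t_uniq := lexi_uniq (pairwise_chords 0 t).
rewrite (@forget_subtree_at _ _ ft (chords_ordered tN) t_uniq _ _ None) //.
rewrite /= neighbours_chords_low filter_predT.
(* The root uses one unit of the bound [N.+1], which leaves [N] for its children. *)
by rewrite (explore_chords 0 (chords 0 t) (m := N) _).1 ?tN.
Qed.

Lemma represents_increasing f t : leaves t = N.+1 ->
  represents (chords 0 t) f -> increasing_factorisations N.+1 f.
Proof.
move=> tN ft; have t_ord := chords_ordered tN.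
split.
  split=> [k|].
    have /andP[lt_e leN] := pair_represents ft t_ord k.
    exists (inord (nth (0, 0) (chords 0 t) k).1), (inord (nth (0, 0) (chords 0 t) k).2).
    split; last exact: (tnth_represents ft).
    by rewrite !inordE //; apply: leq_trans leN; apply: ltnW.
  by rewrite (prod_represents ft) prod_chords ?tN // prod_cycle_pairs_long_cycle.
move=> k l a b c d ab /eqP + cd /eqP.
rewrite !(represents_tperm ft) // => /eqP ek /eqP el.
rewrite leq_eqVlt => /orP[/eqP/val_inj ekl|kl].
  by move: ek; rewrite ekl el => -[->].
have /(pairwiseP (0, 0))/(_ k l) := pairwise_chords 0 t.
rewrite !inE (size_represents ft) !ltn_ord ek el /lexi /= => /(_ isT isT kl).
by lia.
Qed.

Lemma increasing_represents f : increasing_factorisations N.+1 f ->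
  exists2 t, leaves t = N.+1 & represents (chords 0 t) f.
Proof.
case=> -[f_tperm f_prod] f_incr.
have /fin_all_exists[a /fin_all_exists[b ab]] := f_tperm.
pose s := [seq (val (a k), val (b k)) | k <- enum 'I_N].
have sf : represents s f.
  rewrite /represents -map_comp -[LHS]map_tnth_enum; apply: eq_map => k /=.
  by rewrite (ab k).2 /transp !inord_val.
have good_s : minimal_increasing N 0 s.
  apply/and3P; split.
  (* The product has a single cycle and there are [N] transpositions, which is the equality case. *)
  - rewrite /minimal -(prod_represents sf) f_prod nb_cycles_long_cycle.
    by rewrite size_map size_enum_ord add1n.
  - rewrite /unzip1 -map_comp pairwise_map.
    have : pairwise (fun k l : 'I_N => k < l) (enum 'I_N).
      rewrite -(pairwise_map val ltn) val_enum_ord -sorted_pairwise.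
        exact: iota_ltn_sorted.
      exact: ltn_trans.
    apply: sub_pairwise => k l kl /=.
    by apply: (f_incr k l _ _ _ _ (ab k).1 (ab k).2 (ab l).1 (ab l).2 (ltnW kl)).
  - rewrite all_map; apply/allP => k _ /=.
    by rewrite (ab k).1 -ltnS ltn_ord.
(* A single block containing all the points yields a forest with a single tree. *)
have [||||[|t [|//]] //= [tN] sE] := @minimal_increasing_forest N 0 [:: N.+1] s.
- by rewrite /= addn0.
- by [].
- by [].
- by rewrite -(prod_represents sf) f_prod /= cats0 prod_cycle_pairs_long_cycle.
by exists t => //; rewrite cats0 in sE; rewrite -sE.
Qed.

Lemma represents_exists t : leaves t = N.+1 -> exists f, represents (chords 0 t) f.
Proof.
move=> tN.
have sizeN : size [seq T e.1 e.2 | e <- chords 0 t] == N.+1.-1.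
  by rewrite size_map size_chords tN.
by exists (Tuple sizeN).
Qed.

End Factorisations.

Theorem proposition9 (n : nat) (hn : 2 <= n) :
  set_bij (increasing_factorisations n) (plane_trees n) (T3 hn).
Proof.
case: n hn => // N hn; split.
- move=> f /increasing_represents[t tN ft].
  by rewrite (T3_represents hn tN ft) /plane_trees /= -tN; case: (nb_vertices_children t).
- move=> f g /set_mem/increasing_represents[t tN ft].
  move=> /set_mem/increasing_represents[u uN gu].
  rewrite (T3_represents hn tN ft) (T3_represents hn uN gu) => -[/children_inj.1 etu].
  by apply: val_inj; rewrite /= ft gu etu.
- move=> [ts] tsN; have [[t tE] _] := children_surj ts.
  have tN : leaves t = N.+1 by rewrite -(nb_vertices_children t).1 tE.
  have [f ft] := represents_exists tN.
  exists f; first exact: represents_increasing tN ft.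
  by rewrite (T3_represents hn tN ft) tE.
Qed.
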